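(* Let $\mathbf{b} = (b_1,b_2)$ be a vector of positive integers with $\gcd(b_1,b_2)=1$ and $\mathbf{b}\neq(1,1)$. Then there exists a set $A\subseteq\mathbb{N}$ such that $$1\leq r_{A,\mathbf{b}}(n)\leq (b_1+1)(b_2+1)\qquad\text{for every integer } n\geq b_1b_2.$$
   Context: $\mathbb{N}=\mathbb{Z}_{\geq 0}$. For $A\subseteq\mathbb{N}$ and $\mathbf{b}=(b_1,b_2)$ a vector of positive integers, the representation function is $$r_{A,\mathbf{b}}(n):=\#\{(x_1,x_2)\in A^2 \mid b_1x_1+b_2x_2=n\}.$$ *)

(* Defs.v *)
From mathcomp Require Import all_boot finmap boolp classical_sets functions cardinality.

Set Implicit Arguments.
Unset Strict Implicit.
Unset Printing Implicit Defensive.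

Local Open Scope classical_set_scope.

Definition reprs (A : set nat) (b : nat * nat) (n : nat) : set (nat * nat) :=
  [set x | [/\ A x.1, A x.2 & b.1 * x.1 + b.2 * x.2 = n]].

(* [fset_set] sends infinite sets to [fset0]; by [finite_reprs] this default
   value is never used when both coefficients are positive. *)
Definition repr_count (A : set nat) (b : nat * nat) (n : nat) : nat :=
  #|` fset_set (reprs A b n)|%fset.

Lemma finite_reprs (A : set nat) (b : nat * nat) (n : nat) :
  0 < b.1 -> 0 < b.2 -> finite_set (reprs A b n).
Proof.
move=> b1 b2; apply: (@sub_finite_set _ _ (`I_n.+1 `*` `I_n.+1)); last first.
  by apply: finite_setX; exact: finite_II.
case=> x y [_ _ /= <-]; split; rewrite /= ltnS.
  by apply: leq_trans (leq_addr _ _); exact: leq_pmull.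
by apply: leq_trans (leq_addl _ _); exact: leq_pmull.
Qed.

(* Main.v *)
Require Import Defs.
From mathcomp Require Import all_boot finmap boolp classical_sets functions cardinality.
From mathcomp Require Import zify.

(** Say [b = (p, q)] with [q > 1], the other case being symmetric.  Let [S] be
    the set of integers whose base-[q^2] digits are all smaller than [q].  Every
    [t] is [s + q * s'] with [s, s'] in [S], and for [c] coprime to [q] the map
    [(s, s') |-> c * s + q * s'] is injective on [S * S], as one sees by reading
    the digits modulo [q] from the lowest one up.  Put
    [U = {u + q * s : u < q, s in S}], [V = {v + p * q * s : v < p, s in S}] and
    [A = U `|` V].  For [n >= p * q], write [n = p * u + q * v + p * q * t] with
    [u < q], [v < p] and split [t]: this represents [n] with [(x, y)] in
    [U * V].  Conversely, attach to a representation [(x, y)] of [n] either the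
    fact that [x] is in [U] or else [x %% p], and either the fact that [y] is in
    [V] or else [y %% q]: there are [(p + 1) * (q + 1)] such codes, and in each
    of the four cases the code determines all residues, whence [(x, y)] by the
    injectivity for [c = 1], [p], [p] and [p^2] respectively. *)

Set Implicit Arguments.
Unset Strict Implicit.
Unset Printing Implicit Defensive.

Lemma eqn_mod_coprimeM c q x y : coprime c q ->
  (c * x == c * y %[mod q]) = (x == y %[mod q]).
Proof.
move=> cq; wlog le_yx : x y / y <= x.
  by move=> H; case/orP: (leq_total x y) => /H // E; rewrite eq_sym E eq_sym.
rewrite !eqn_mod_dvd ?leq_mul2l ?le_yx ?orbT // -mulnBr Gauss_dvdr //.
by rewrite coprime_sym.
Qed.

Lemma lin_modl p q x y x' y' : coprime p q ->
  p * x + q * y = p * x' + q * y' -> x %% q = x' %% q.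
Proof.
move=> pq E; apply/eqP; rewrite -(eqn_mod_coprimeM x x' pq).
have := congr1 (modn^~ q) E.
by rewrite /= ![p * _ + _]addnC ![q * _]mulnC !modnMDl => ->.
Qed.

Lemma digit_step q d e s z : 0 < q -> d < q -> e < q ->
  d + q * s = e + q * z -> d = e /\ s = z.
Proof.
move=> q0 dq eq E; have de : d = e.
  have := congr1 (modn^~ q) E.
  by rewrite /= ![_ + q * _]addnC ![q * _]mulnC !modnMDl !modn_small.
split=> //; move: E; rewrite de => /addnI /eqP.
by rewrite eqn_pmul2l // => /eqP.
Qed.

Inductive sparse (q : nat) : nat -> Prop :=
| sparse0 : sparse q 0
| sparseD d s : d < q -> sparse q s -> sparse q (d + q * (q * s)).

(** The number 0 also has the shape of [sparseD], with [d] and [s2] both 0, so one form covers both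
    constructors. *)
Lemma sparse_inv q s : 0 < q -> sparse q s ->
  exists d s2, [/\ d < q, sparse q s2 & s = d + q * (q * s2)].
Proof.
move=> q0; case=> [|d s2 dq Ss2]; first by exists 0, 0; split=> //; [left | lia].
by exists d, s2.
Qed.

(** The base-[q] digits of [t] at even positions go to [s], those at odd positions to [s']. *)
Lemma sparse_split q t : 1 < q ->
  exists s s', [/\ sparse q s, sparse q s' & t = s + q * s'].
Proof.
move=> q1; have q0 : 0 < q by apply: ltnW.
elim/ltn_ind: t => -[_|t IH]; first by exists 0, 0; split; [left..|lia].
have lt_t : t.+1 %/ q %/ q < t.+1.
  by apply: leq_ltn_trans (leq_div _ _) _; apply: ltn_Pdiv.
have [s [s' [Ss Ss' Et]]] := IH _ lt_t.
exists (t.+1 %% q + q * (q * s)), ((t.+1 %/ q) %% q + q * (q * s')).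
split; [by right; rewrite ?ltn_mod | by right; rewrite ?ltn_mod |].
rewrite [LHS](divn_eq _ q) [t.+1 %/ q in LHS](divn_eq _ q) Et; lia.
Qed.

(** Once the lowest digits of [s] and [s'] are cancelled, the equation has the same shape with the
    same [c], which allows induction on [s + s']. *)
Lemma sparse_inj q c s s' z z' : 1 < q -> 0 < c -> coprime c q ->
  sparse q s -> sparse q s' -> sparse q z -> sparse q z' ->
  c * s + q * s' = c * z + q * z' -> s = z /\ s' = z'.
Proof.
move=> q1 c0 cq; have q0 : 0 < q by apply: ltnW.
have [k] := ubnP (s + s').
elim: k => // k IH in s s' z z' * => lek Ss Ss' Sz Sz' E.
(* Dropping digits does not decrease a zero sum, so this case is settled first. *)
have [/eqP|s_gt0] := posnP (s + s').
  rewrite addn_eq0 => /andP[/eqP s0 /eqP s'0].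
  move: E; rewrite s0 s'0 !muln0 => /esym/eqP.
  by rewrite addn_eq0 !muln_eq0 => /andP[/orP[]/eqP ? /orP[]/eqP ?]; lia.
have [d [s2 [dq Ss2 Es]]] := sparse_inv q0 Ss.
have [d' [s2' [d'q Ss2' Es']]] := sparse_inv q0 Ss'.
have [e [z2 [eq Sz2 Ez]]] := sparse_inv q0 Sz.
have [e' [z2' [e'q Sz2' Ez']]] := sparse_inv q0 Sz'.
have de : d = e.
  have := lin_modl cq E; rewrite Es Ez.
  by rewrite ![_ + q * _]addnC ![q * _]mulnC !modnMDl !modn_small.
have E1 : d' + q * (c * s2 + q * s2') = e' + q * (c * z2 + q * z2').
  apply/eqP; rewrite -(eqn_pmul2l q0) -(eqn_add2l (c * d)) [in X in _ == X]de.
  by apply/eqP; move: E; rewrite Es Es' Ez Ez'; lia.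
have [de' E2] := digit_step q0 d'q e'q E1.
have lt2 : s2 + s2' < k.
  have le4 : 4 * s2 <= q * (q * s2) by rewrite mulnA leq_mul2r (@leq_mul 2 2) ?orbT.
  have le4' : 4 * s2' <= q * (q * s2') by rewrite mulnA leq_mul2r (@leq_mul 2 2) ?orbT.
  lia.
have [Esz Esz'] := IH _ _ _ _ lt2 Ss2 Ss2' Sz2 Sz2' E2.
by rewrite Es Es' Ez Ez' de de' Esz Esz'.
Qed.

Local Open Scope classical_set_scope.

(* The sets [U] and [V] above are [thick q q q] and [thick q p (p * q)]. *)
Definition thick (q r m : nat) : set nat :=
  [set x | exists u s, [/\ u < r, sparse q s & x = u + m * s]].

(** As [r] divides [m], the offset [u < r] is the residue modulo [r]. *)
Lemma thick_congr q r m k x x' : 0 < r -> m = r * k ->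
  thick q r m x -> thick q r m x' -> x %% r = x' %% r ->
  exists u s s', [/\ sparse q s, sparse q s', x = u + m * s & x' = u + m * s'].
Proof.
move=> r0 -> [u [s [ur Ss ->]]] [u' [s' [u'r Ss' ->]]].
rewrite -!mulnA ![_ + r * _]addnC ![r * _]mulnC !modnMDl !modn_small // => uu'.
by exists u, s, s'; rewrite uu'; split=> //; lia.
Qed.

(** The shared offsets cancel, and dividing by the common factor [l] leaves the equation of
    [sparse_inj]. *)
Lemma thick_inj p q c m m' l n x y x' y' u v s s' z z' :
  1 < q -> 0 < c -> coprime c q -> 0 < l -> p * m = l * c -> q * m' = l * q ->
  sparse q s -> sparse q s' -> sparse q z -> sparse q z' ->
  x = u + m * s -> x' = u + m * z -> y = v + m' * s' -> y' = v + m' * z' ->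
  p * x + q * y = n -> p * x' + q * y' = n -> (x, y) = (x', y').
Proof.
move=> q1 c0 cq l0 El El' Ss Ss' Sz Sz' -> -> -> -> <-.
rewrite !mulnDr !mulnA El El' => E.
suff [-> ->] : s = z /\ s' = z' by [].
apply: (sparse_inj q1 c0 cq) => //.
by apply/eqP; rewrite -(eqn_pmul2l l0); apply/eqP; lia.
Qed.

Lemma coprime_repr p q n : 0 < p -> 0 < q -> coprime p q -> p * q <= n ->
  exists u v t, [/\ u < q, v < p & n = p * u + q * v + p * q * t].
Proof.
move=> p0 q0 pq le_n.
have [u uq Eu] : exists2 u, u < q & p * u = n %[mod q].
  case: (@egcdnP p q p0) => km kn Ek _.
  (* [km] is an inverse of [p] modulo [q]. *)
  exists ((n * km) %% q); first by rewrite ltn_mod.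
  rewrite modnMmr (_ : p * (n * km) = n * kn * q + n) ?modnMDl //.
  have : km * p = kn * q + 1 by rewrite Ek (eqP pq).
  by move=> E; rewrite mulnCA (mulnC p) E; lia.
(* The bound [p * q <= n] keeps [n - p * u] from being truncated. *)
have le_u : p * u <= n by apply: leq_trans le_n; rewrite leq_mul2l ltnW ?orbT.
have /dvdnP[w Ew] : q %| n - p * u.
  by rewrite -eqn_mod_dvd // Eu.
exists u, (w %% p), (w %/ p); split; rewrite ?ltn_mod //.
by have := divn_eq w p; move: Ew le_u; nia.
Qed.

Lemma fset_set_card_le (T U : choiceType) (X : set T) (f : T -> U) (l : seq U) :
  finite_set X -> {in X &, injective f} -> (forall x, X x -> f x \in l) ->
  #|` fset_set X|%fset <= size l.
Proof.
move=> finX injf fl; rewrite -(size_map f).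
apply: uniq_leq_size => [|_ /mapP[x xX ->]]; last first.
  by apply: fl; move: xX; rewrite in_fset_set // inE.
rewrite map_inj_in_uniq // => x y; rewrite !in_fset_set //; exact: injf.
Qed.

Lemma repr_count_swap A p q n : 0 < p -> 0 < q ->
  repr_count A (p, q) n = repr_count A (q, p) n.
Proof.
move=> p0 q0; wlog suff le_swap : p q p0 q0 /
    repr_count A (p, q) n <= repr_count A (q, p) n.
  by apply/eqP; rewrite eqn_leq !le_swap.
apply: (@fset_set_card_le _ _ _ (fun x => (x.2, x.1))).
- exact: finite_reprs.
- by move=> [x y] [x' y'] _ _ /= [-> ->].
- move=> [x y] [/= Ax Ay E]; rewrite in_fset_set ?inE; last exact: finite_reprs.
  by split=> //=; rewrite addnC.
Qed.

Definition thick_basis (p q : nat) : set nat :=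
  thick q q q `|` thick q p (p * q).

Lemma thick_basis_repr p q n : 0 < p -> 1 < q -> coprime p q -> p * q <= n ->
  1 <= repr_count (thick_basis p q) (p, q) n.
Proof.
move=> p0 q1 pq le_n; have q0 : 0 < q by apply: ltnW.
have [u [v [t [uq vp En]]]] := coprime_repr p0 q0 pq le_n.
have [s [s' [Ss Ss' Et]]] := sparse_split t q1.
rewrite cardfs_gt0; apply/fset0Pn; exists (u + q * s, v + p * q * s').
rewrite in_fset_set ?inE; last exact: finite_reprs.
split=> /=; first by left; exists u, s.
  by right; exists v, s'.
by rewrite En Et; lia.
Qed.

(** Residues are shifted by one so that 0 can stand for membership. *)
Definition repr_code (p q : nat) (x : nat * nat) : nat * nat :=
  (if `[< thick q q q x.1 >] then 0 else (x.1 %% p).+1,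
   if `[< thick q p (p * q) x.2 >] then 0 else (x.2 %% q).+1).

Lemma repr_code_inj p q n : 0 < p -> 1 < q -> coprime p q ->
  {in reprs (thick_basis p q) (p, q) n &, injective (repr_code p q)}.
Proof.
move=> p0 q1 pq [x y] [x' y']; rewrite !inE => -[/= Ax Ay E] [/= Ax' Ay' E'].
have q0 : 0 < q by apply: ltnW.
(* These two residues depend on [n] alone, so the code 0 need not record them. *)
have xx' : x = x' %[mod q] by apply: (lin_modl pq (etrans E (esym E'))).
have yy' : y = y' %[mod p].
  apply: (@lin_modl q p y x y' x'); first by rewrite coprime_sym.
  by rewrite ![q * _ + _]addnC E E'.
have Eq : q = q * 1 by rewrite muln1.
rewrite /repr_code /=; case.
(* Equal codes put [x], [x'] in the same set, and likewise [y], [y']. The four cases left have [l]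
   equal to [p * q], [q], [p * q] and [q]. *)
case: (asboolP (thick q q q x)) Ax => [Ux _|nUx [//|Vx]];
  case: (asboolP (thick q q q x')) Ax' => [Ux' _ Ex|nUx' [//|Vx'] Ex] //;
  case: (asboolP (thick q p (p * q) y)) Ay => [Vy _|nVy [Uy|//]];
  case: (asboolP (thick q p (p * q) y')) Ay' => [Vy' _ Ey|nVy' [Uy'|//] Ey] //.
- have [u [s [z [? ? ? ?]]]] := thick_congr q0 Eq Ux Ux' xx'.
  have [v [s' [z' [? ? ? ?]]]] := thick_congr p0 (erefl _) Vy Vy' yy'.
  by apply: (@thick_inj p q 1 q (p * q) (p * q) n x y x' y' u v s s' z z') => //;
    rewrite ?coprime1n ?muln_gt0 ?p0 //; lia.
- have [u [s [z [? ? ? ?]]]] := thick_congr q0 Eq Ux Ux' xx'.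
  case: Ey => Ey.
  have [v [s' [z' [? ? ? ?]]]] := thick_congr q0 Eq Uy Uy' Ey.
  by apply: (@thick_inj p q p q q q n x y x' y' u v s s' z z') => //; lia.
- case: Ex => Ex.
  have [u [s [z [? ? ? ?]]]] := thick_congr p0 (erefl _) Vx Vx' Ex.
  have [v [s' [z' [? ? ? ?]]]] := thick_congr p0 (erefl _) Vy Vy' yy'.
  by apply: (@thick_inj p q p (p * q) (p * q) (p * q) n x y x' y' u v s s' z z')
    => //; rewrite ?muln_gt0 ?p0 //; lia.
- case: Ex => Ex; case: Ey => Ey.
  have [u [s [z [? ? ? ?]]]] := thick_congr p0 (erefl _) Vx Vx' Ex.
  have [v [s' [z' [? ? ? ?]]]] := thick_congr q0 Eq Uy Uy' Ey.
  by apply: (@thick_inj p q (p * p) (p * q) q q n x y x' y' u v s s' z z') => //;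
    rewrite ?coprimeMl ?pq ?muln_gt0 ?p0 //; lia.
Qed.

Lemma thick_basis_count p q n : 0 < p -> 1 < q -> coprime p q ->
  repr_count (thick_basis p q) (p, q) n <= (p + 1) * (q + 1).
Proof.
move=> p0 q1 pq; have q0 : 0 < q by apply: ltnW.
have -> : (p + 1) * (q + 1) =
    size [seq (i, j) | i <- iota 0 (p + 1), j <- iota 0 (q + 1)].
  by rewrite size_allpairs !size_iota.
apply: (@fset_set_card_le _ _ _ (repr_code p q)).
- exact: finite_reprs.
- exact: repr_code_inj.
- move=> x _; apply/allpairsP; exists (repr_code p q x).
  rewrite -surjective_pairing !mem_iota /= !add0n !addn1 !ltnS.
  by split=> //; case: ifP => // _; rewrite ltn_mod.
Qed.

Theorem theorem1p1 (b : nat * nat) (hb1 : 0 < b.1) (hb2 : 0 < b.2)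
  (hgcd : gcdn b.1 b.2 = 1) (hb : b <> (1, 1)) :
  exists A : set nat, forall n : nat, b.1 * b.2 <= n ->
    1 <= repr_count A b n <= (b.1 + 1) * (b.2 + 1).
Proof.
case: b hb1 hb2 hgcd hb => p q /= p0 q0 /eqP pq neq11.
have [q1|q_le1] := ltnP 1 q.
  exists (thick_basis p q) => n le_n.
  by rewrite thick_basis_repr ?thick_basis_count.
have p1 : 1 < p.
  by have [//|p_le1] := ltnP 1 p; case: neq11; congr pair; lia.
have qp : coprime q p by rewrite coprime_sym.
exists (thick_basis q p) => n; rewrite mulnC => le_n.
rewrite repr_count_swap // [(p + 1) * _]mulnC.
by rewrite thick_basis_repr ?thick_basis_count.
Qed.
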